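(* There exists an irrational number $\alpha$ such that the Hausdorff dimension of $\mathcal S(\alpha)\cap\left(-\frac12,\frac12\right)$ is positive but less than $1$. In particular, $\mathcal S(\alpha)\cap\left(-\frac12,\frac12\right)$ is an uncountable set and its Lebesgue measure is $0$.
   Context: For $\alpha\in\mathbb R$, $\mathcal S(\alpha)\subset\mathbb R$ denotes the set of all accumulation points of the set $\left\{ m^2\left(\frac{k}{m}-\alpha\right) : k,m\in\mathbb Z,\ m\neq 0\right\}$. The pairs $(k,m)$ are not required to be coprime. *)

(* Defs.v *)
From mathcomp Require Import all_boot all_order all_algebra.
From mathcomp Require Import all_classical all_reals all_analysis.
Set Implicit Arguments.
Unset Strict Implicit.
Unset Printing Implicit Defensive.
Import Order.TTheory GRing.Theory Num.Theory.
Import numFieldNormedType.Exports.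
Local Open Scope classical_set_scope.
Local Open Scope ring_scope.

Section approximation.
Context {R : realType}.

Definition approx_values (alpha : R) : set R :=
  [set x | exists k m : int,
     m != 0 /\ x = m%:~R ^+ 2 * (k%:~R / m%:~R - alpha)].

Definition approx_spectrum (alpha : R) : set R :=
  limit_point (approx_values alpha).

End approximation.

Section hausdorff.
Local Open Scope ereal_scope.
Context {R : realType}.
Implicit Types (A : set R) (s delta : R).

(* For the empty set the supremum is -oo; [diam_pow] treats that case apart. *)
Definition diam A : \bar R :=
  ereal_sup [set (`|x - y|%R)%:E | x in A & y in A].

(* (diam A)^s with the conventions 0^0 = 1 and (diam set0)^s = 0, so that the
   0-dimensional Hausdorff measure is the counting measure. *)
Definition diam_pow s A : \bar R :=
  if A == set0 then 0 else diam A `^ s.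

Definition delta_cover delta A : set (nat -> set R) :=
  [set U | A `<=` \bigcup_i U i /\ forall i, diam (U i) <= delta%:E].

Definition hausdorff_premeasure s delta A : \bar R :=
  ereal_inf [set \sum_(i <oo) diam_pow s (U i) | U in delta_cover delta A].

(* The premeasure is nonincreasing in delta, so its limit as delta tends to 0
   from the right is its supremum over delta > 0. *)
Definition hausdorff_measure s A : \bar R :=
  ereal_sup [set hausdorff_premeasure s delta A | delta in [set d | (0 < d)%R]].

Definition hausdorff_dim A : \bar R :=
  ereal_inf [set s%:E | s in [set s | (0 <= s)%R /\ hausdorff_measure s A = 0]].

End hausdorff.

(* Main.v *)
(* Take alpha = [0; 3 + a_0, 3 + a_1, ...] with binary digits a_n. By Legendre's theorem every
   value m (k - m alpha) of modulus < 1/2 comes from a multiple of a convergent; as all partial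
   quotients are 3 or 4, proper multiples are excluded, and the value is one of
     v_n = +- 1 / (1 / [0; 3 + a_n, ...] + [0; 3 + a_(n-1), ..., 3 + a_0]).
   The map u |-> 1 / (3 + d + u) contracts [0, 1/3] by a factor at least 9, so v_n is known up to
   9^-N from its sign and the 2N digits around n: S is covered by about 2 * 4^N intervals of length
   9^-N, and 4 < 9^(3/4) gives dimension <= 3/4 and measure 0.
   If every binary word occurs in (a_n) after arbitrarily long runs of zeros, then S contains
   - 1 / (1 / [0; 3 + b_0, ...] + [0; 3, 3, ...]) for all binary sequences b. Changing b_n moves this
   point by at least 32^-(n+2), whereas the real number with binary expansion b moves by at most
   2^-n = (32^-n)^(1/5): a subset of S maps onto [0, 1) by a 1/5-Hoelder map, so that the dimension
   of S is >= 1/5 and S is uncountable. *)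

Require Import Defs.
From mathcomp Require Import all_boot all_order all_algebra.
From mathcomp Require Import all_classical all_reals all_analysis.
From mathcomp Require Import zify ring lra.
Import Order.TTheory GRing.Theory Num.Theory.
Import numFieldNormedType.Exports.
Local Open Scope classical_set_scope.
Local Open Scope ring_scope.

(** * Continued fractions with partial quotients 3 and 4 *)

Section continued_fractions.
Context {R : realType}.
Implicit Types (u v x y : R) (b c : nat -> bool) (w : seq bool).

Definition cf_step (d : bool) u : R := (3 + d%:R + u)^-1.

Definition cf_word w u : R := foldr cf_step u w.

Lemma digit_bounds (d : bool) : 0 <= (d%:R : R) <= 1.
Proof. by case: d; rewrite ?lexx ler01. Qed.

Lemma cf_step_bounds d u : 0 <= u <= 1 / 3 -> 0 <= cf_step d u <= 1 / 3.
Proof.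
move=> hu; have hd := digit_bounds d.
rewrite /cf_step invr_ge0; apply/andP; split; first by lra.
by rewrite -div1r ler_pdivrMr; lra.
Qed.

Lemma cf_word_bounds w u : 0 <= u <= 1 / 3 -> 0 <= cf_word w u <= 1 / 3.
Proof. by move=> hu; elim: w => //= d w; exact: cf_step_bounds. Qed.

Lemma cf_step_sub d d' u v : 0 <= u <= 1 / 3 -> 0 <= v <= 1 / 3 ->
  cf_step d u - cf_step d' v =
  (d'%:R - d%:R + v - u) / ((3 + d%:R + u) * (3 + d'%:R + v)).
Proof.
move=> hu hv; have hd := digit_bounds d; have hd' := digit_bounds d'.
by rewrite /cf_step; field; apply/andP; split; apply/eqP; lra.
Qed.

(** Both denominators are at least 3, whence the factor 1/9. *)
Lemma cf_step_contract d u v : 0 <= u <= 1 / 3 -> 0 <= v <= 1 / 3 ->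
  `|cf_step d u - cf_step d v| <= 9^-1 * `|u - v|.
Proof.
move=> hu hv; have hd := digit_bounds d.
rewrite cf_step_sub// subrr add0r normrM (distrC v) mulrC normfV.
rewrite ler_wpM2r// gtr0_norm; last by nra.
by rewrite lef_pV2 ?posrE; nra.
Qed.

Lemma cf_word_contract w u v : 0 <= u <= 1 / 3 -> 0 <= v <= 1 / 3 ->
  `|cf_word w u - cf_word w v| <= 9^-1 ^+ size w * `|u - v|.
Proof.
move=> hu hv; elim: w => [|d w IH] /=; first by rewrite mul1r.
apply: le_trans (cf_step_contract _ _ _ _ _) _; try exact: cf_word_bounds.
by rewrite exprS -mulrA ler_pM2l ?invr_gt0.
Qed.

Lemma ninth_pow_small e : 0 < e -> exists n, (9^-1 ^+ n : R) < e.
Proof.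
move=> e0; have : (9^-1 ^+ n : R) @[n --> \oo] --> 0.
  by apply: cvg_expr; rewrite ger0_norm; lra.
move=> /cvgr0Pnorm_lt /(_ _ e0) [N _ /(_ N (leqnn N))].
by rewrite ger0_norm ?exprn_ge0// => ?; exists N.
Qed.

(* The limit of the truncations, written as the supremum of lower bounds for it. *)
Definition cf b : R :=
  sup (range (fun n => cf_word (mkseq b n) 0 - 9^-1 ^+ n)).

(** The longer truncation is the word of length [n] applied to a point of [0, 1/3] in place of 0, so
    the contraction estimate applies. *)
Lemma cf_trunc_cauchy b n m : (n <= m)%N ->
  `|cf_word (mkseq b n) 0 - cf_word (mkseq b m) 0| <= 9^-1 ^+ n.
Proof.
move=> nm; rewrite -(subnKC nm) /mkseq iotaD map_cat {2}/cf_word foldr_cat.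
have h0 : 0 <= (0 : R) <= 1 / 3 by lra.
have hw := cf_word_bounds [seq b i | i <- iota (0 + n) (m - n)] _ h0.
apply: le_trans (cf_word_contract _ _ _ h0 hw) _.
rewrite size_map size_iota sub0r normrN ger0_norm; last by case/andP: hw.
rewrite ler_piMr ?exprn_ge0//; lra.
Qed.

Lemma cf_approx b n : `|cf b - cf_word (mkseq b n) 0| <= 9^-1 ^+ n.
Proof.
pose l n : R := cf_word (mkseq b n) 0 - 9^-1 ^+ n.
(* Every truncation minus its error lies below every truncation plus its error, so the supremum
   stays within each error bar. *)
have ub k : ubound (range l) (cf_word (mkseq b k) 0 + 9^-1 ^+ k).
  move=> _ [m _ <-]; rewrite /l lerBlDr.
  have h i : 0 <= (9^-1 : R) ^+ i by exact: exprn_ge0.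
  have [km|/ltnW mk] := leqP k m.
    have := cf_trunc_cauchy b _ _ km; rewrite ler_norml.
    by have := h m; lra.
  have := cf_trunc_cauchy b _ _ mk; rewrite ler_norml.
  by have := h k; lra.
have ne : range l !=set0 by exists (l 0%N); exists 0%N.
have h1 : l n <= cf b.
  by apply: sup_upper_bound; [split=> //; exists (cf_word (mkseq b n) 0 + 9^-1 ^+ n)|exists n].
have h2 : cf b <= cf_word (mkseq b n) 0 + 9^-1 ^+ n by exact: ge_sup.
by rewrite ler_norml; move: h1 h2; rewrite /l; lra.
Qed.

Lemma eq_of_ninth_pow x y : (forall n, `|x - y| <= 9^-1 ^+ n *+ 2) -> x = y.
Proof.
move=> h; apply/eqP; rewrite -subr_eq0 -normr_eq0 eq_le normr_ge0 andbT.
rewrite leNgt; apply/negP => e0.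
have [n hn] := ninth_pow_small _ (divr_gt0 e0 (ltr0n _ 2)).
by have := h n; rewrite leNgt -mulr_natr -ltr_pdivlMr ?hn.
Qed.

Lemma cf_bounds b : 0 <= cf b <= 1 / 3.
Proof.
have h0 : 0 <= (0 : R) <= 1 / 3 by lra.
have key e : 0 < e -> - e <= cf b <= 1 / 3 + e.
  move=> /ninth_pow_small[n hn]; have := cf_approx b n; rewrite ler_norml.
  by have := cf_word_bounds (mkseq b n) _ h0; lra.
by apply/andP; split; apply/ler_addgt0Pr => e /key; lra.
Qed.

Lemma cfE b : cf b = cf_step (b 0%N) (cf (fun n => b n.+1)).
Proof.
(* Both sides lie within [9^-1 ^+ n] of the truncation of length [n.+1]. *)
apply: eq_of_ninth_pow => n.
have h0 : 0 <= (0 : R) <= 1 / 3 by lra.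
have e1 := cf_approx b n.+1.
have := cf_step_contract (b 0%N) _ _ (cf_bounds (fun n => b n.+1))
  (cf_word_bounds (mkseq (fun n => b n.+1) n) _ h0).
have -> : cf_step (b 0%N) (cf_word (mkseq (fun n => b n.+1) n) 0) =
  cf_word (mkseq b n.+1) 0.
  by rewrite /mkseq /= -[1%N]/(1 + 0)%N iotaDl -map_comp.
move=> e2; have e3 := cf_approx (fun n => b n.+1) n.
have e4 : 9^-1 ^+ n.+1 <= (9^-1 ^+ n : R).
  by rewrite exprS ler_piMl ?exprn_ge0//; lra.
have e5 : 0 <= (9^-1 ^+ n : R) by exact: exprn_ge0.
have : 9^-1 * `|cf (fun n => b n.+1) - cf_word (mkseq (fun n => b n.+1) n) 0| <= 9^-1 * 9^-1 ^+ n.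
  by rewrite ler_pM2l ?invr_gt0.
rewrite -exprS => e6; have {e2 e3 e6} e2 := le_trans e2 e6.
move: e1 e2; rewrite !ler_norml mulr2n; lra.
Qed.

Lemma cf_shift b n : cf b = cf_word (mkseq b n) (cf (fun i => b (n + i)%N)).
Proof.
elim: n => [|n IH] in b *; first by rewrite /=.
rewrite cfE /mkseq /= -[1%N]/(1 + 0)%N iotaDl -map_comp.
by congr cf_step; exact: IH.
Qed.

Lemma cf_agree b c n : (forall i, (i < n)%N -> b i = c i) ->
  `|cf b - cf c| <= 9^-1 ^+ n / 3.
Proof.
move=> bc; rewrite (cf_shift b n) (cf_shift c n).
have -> : mkseq b n = mkseq c n.
  by apply/eq_in_map => i; rewrite mem_iota => /andP[_]; exact: bc.
have h1 := cf_bounds (fun i => b (n + i)%N).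
have h2 := cf_bounds (fun i => c (n + i)%N).
apply: le_trans (cf_word_contract _ _ _ h1 h2) _; rewrite size_mkseq.
by rewrite ler_wpM2l ?exprn_ge0// ler_norml; lra.
Qed.

Lemma cf_gt0 b : 0 < cf b.
Proof.
rewrite cfE invr_gt0; have := cf_bounds (fun n => b n.+1).
by have := digit_bounds (b 0%N); lra.
Qed.

(** One step divides a difference by at most (13/3)^2 < 32; at the first differing digit the gap is
    at least (2/3) / (130/9) > 1/32. The choice 32 = 2^5 leads to the Hoelder exponent 1/5. *)
Lemma cf_separate b c n : (forall i, (i < n)%N -> b i = c i) -> b n != c n ->
  32^-1 ^+ n.+1 <= `|cf b - cf c|.
Proof.
elim: n => [|n IH] in b c *.
  move=> _; rewrite (cfE b) (cfE c) expr1.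
  have hb := cf_bounds (fun n => b n.+1); have hc := cf_bounds (fun n => c n.+1).
  move: (cf (fun n => b n.+1)) (cf (fun n => c n.+1)) hb hc => u v hb hc bc.
  have key x y : 0 <= x <= 1 / 3 -> 0 <= y <= 1 / 3 ->
      32^-1 <= `|cf_step true x - cf_step false y|.
    move=> hx hy; rewrite distrC cf_step_sub// ger0_norm; last first.
      by apply: divr_ge0; rewrite ?mulr_ge0//; rewrite /=; lra.
    by rewrite ler_pdivlMr /=; nra.
  by case: (b 0%N) (c 0%N) bc => [] [] // _; [|rewrite distrC]; apply: key.
move=> bc bcn; rewrite (cfE b) (cfE c) (bc 0%N)//.
have /= := IH (fun n => b n.+1) (fun n => c n.+1).
have hb := cf_bounds (fun n => b n.+1); have hc := cf_bounds (fun n => c n.+1).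
move: (cf (fun n => b n.+1)) (cf (fun n => c n.+1)) hb hc => u v hb hc.
move=> /(_ (fun i => bc i.+1) bcn) h.
have hd := digit_bounds (c 0%N).
rewrite cf_step_sub// subrr add0r normrM normfV (distrC v) exprS mulrC.
apply: ler_pM => //.
rewrite gtr0_norm ?mulr_gt0//; try lra.
by rewrite lef_pV2 ?posrE; nra.
Qed.

(* [1 / cf_pair u v = 1 / u + v], so [cf_pair] glues a forward expansion [u] and
   a backward expansion [v] of a two-sided sequence of partial quotients. *)
Definition cf_pair u v : R := u / (1 + v * u).

Lemma cf_pair_dist u v x y :
  0 <= u <= 1 / 3 -> 0 <= v <= 1 / 3 -> 0 <= x <= 1 / 3 -> 0 <= y <= 1 / 3 ->
  `|cf_pair u v - cf_pair x y| <= `|u - x| + `|v - y|.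
Proof.
move=> hu hv hx hy; rewrite /cf_pair.
(* The first term changes the forward part at fixed [v], the second the backward part at fixed [x];
   both Lipschitz factors are at most 1. *)
have -> : u / (1 + v * u) - x / (1 + y * x) =
    (u - x) / ((1 + v * u) * (1 + v * x)) + (y - v) * ((x / (1 + v * x)) * (x / (1 + y * x))).
  by field; do ?[apply/andP; split]; apply/eqP; nra.
apply: le_trans (ler_normD _ _) _; apply: lerD.
  have D1 : 1 <= (1 + v * u) * (1 + v * x).
    have : 0 <= v * u by nra.
    have : 0 <= v * x by nra.
    by nra.
  by rewrite normrM normfV ler_piMr// ger0_norm ?invf_le1; lra.
rewrite normrM (distrC y) ler_piMr//.
have q z : 0 <= z <= 1 / 3 -> 0 <= x / (1 + z * x) <= 1.
  move=> hz; apply/andP; split; first by apply: divr_ge0; nra.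
  by rewrite ler_pdivrMr; nra.
have := q _ hv; have := q _ hy; set s := _ / _; set t := _ / _ => hs ht.
by rewrite ger0_norm; nra.
Qed.

(** The extra factor 1/32 absorbs the denominator of the difference of the two pairs, which is at
    most 4. *)
Lemma cf_pair_separate b c v n : 0 <= v <= 1 / 3 ->
  (forall i, (i < n)%N -> b i = c i) -> b n != c n ->
  32^-1 ^+ n.+2 <= `|cf_pair (cf b) v - cf_pair (cf c) v|.
Proof.
move=> hv bc bcn; have := cf_separate _ _ _ bc bcn.
have := cf_bounds b; have := cf_bounds c; move: (cf b) (cf c) => u x hx hu h.
have -> : cf_pair u v - cf_pair x v = (u - x) / ((1 + v * u) * (1 + v * x)).
  by rewrite /cf_pair; field; do ?[apply/andP; split]; apply/eqP; nra.
rewrite normrM normfV exprS mulrC; apply: ler_pM => //.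
rewrite gtr0_norm ?mulr_gt0//; try nra.
have : 0 <= v * u <= 1 by nra.
have : 0 <= v * x <= 1 by nra.
by move=> ? ?; rewrite lef_pV2 ?posrE; nra.
Qed.

End continued_fractions.

(** * Convergents, their values, and Legendre's theorem *)

Section convergents.
Context {R : realType}.
Implicit Types (u v x y : R) (a b c : nat -> bool) (w : seq bool).

Definition tail_from b n : nat -> bool := fun i => b (n + i)%N.

Lemma cf_tail b n : cf (tail_from b n) = cf_step (b n) (cf (tail_from b n.+1)) :> R.
Proof.
rewrite cfE /tail_from addn0; congr (cf_step _ (cf _)).
by apply/funext => i; rewrite addSnnS.
Qed.

(* [cf_back b n = [0; 3 + b (n - 1), ..., 3 + b 0]], which is [q_(n-1) / q_n]. *)
Fixpoint cf_back b n : R := if n is m.+1 then cf_step (b m) (cf_back b m) else 0.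

Lemma cf_back_bounds b n : 0 <= cf_back b n <= 1 / 3.
Proof. by elim: n => [|n IH] /=; [lra|exact: cf_step_bounds]. Qed.

Lemma cf_back_word b k n :
  cf_back b (n + k) = cf_word (mkseq (fun i => b (n + k - i.+1)%N) n) (cf_back b k).
Proof.
elim: n => [//|n IH]; rewrite addSn /= subSS subn0 IH; congr cf_step.
by rewrite /mkseq -[1%N]/(1 + 0)%N iotaDl -map_comp.
Qed.

Lemma cf_back_agree b n c k : (n <= k)%N ->
  (forall i, (i < n)%N -> b (k - i.+1)%N = c i) ->
  `|cf_back b k - cf c| <= 9^-1 ^+ n / 3.
Proof.
move=> /subnKC <-; move: (k - n)%N => {}k bc.
rewrite cf_back_word (cf_shift c n).
have -> : mkseq (fun i => b (n + k - i.+1)%N) n = mkseq c n.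
  by apply/eq_in_map => i; rewrite mem_iota => /andP[_]; exact: bc.
have h1 := cf_back_bounds b k.
have h2 := @cf_bounds R (fun i => c (n + i)%N).
apply: le_trans (cf_word_contract _ _ _ h1 h2) _; rewrite size_mkseq.
by rewrite ler_wpM2l ?exprn_ge0// ler_norml; lra.
Qed.

(* [(1, 0)] yields the numerators and [(0, 1)] the denominators of the convergents of
   [0; 3 + b 0, 3 + b 1, ...], each time the pair (previous, current). *)
Fixpoint continuants b (s : nat * nat) n : nat * nat :=
  if n is m.+1 then
    let t := continuants b s m in (t.2, (3 + b m) * t.2 + t.1)%N
  else s.

Definition cf_num b n := (continuants b (1, 0) n).2.
Definition cf_den b n := (continuants b (0, 1) n).2.

Lemma cf_den_ge b n : (0 < cf_den b n)%N /\ (cf_den b n < cf_den b n.+1)%N.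
Proof.
rewrite /cf_den /=.
have h : (0 < (continuants b (0, 1) n).2)%N by elim: n => //= n; lia.
split; first exact: h.
move: h; move: (continuants _ _ _) => s s0; rewrite mulnDl -addnA.
by apply: ltn_addr; rewrite ltn_Pmull.
Qed.

Lemma cf_den_ltn b m n : (m < n)%N -> (cf_den b m < cf_den b n)%N.
Proof.
elim: n => // n IH; rewrite ltnS leq_eqVlt => /predU1P[->|/IH h].
  by case: (cf_den_ge b n).
by apply: ltn_trans h _; case: (cf_den_ge b n).
Qed.

Lemma cf_den_gt b n : (n < cf_den b n)%N.
Proof.
elim: n => [|n IH]; first by case: (cf_den_ge b 0).
by apply: leq_ltn_trans IH _; case: (cf_den_ge b n).
Qed.

Lemma cf_den_bracket b m : (0 < m)%N ->
  exists n, (cf_den b n <= m < cf_den b n.+1)%N.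
Proof.
move=> m0; have : (m < cf_den b m)%N by exact: cf_den_gt.
move: {2}m => k; elim: k => [|k IH] h; first by rewrite /cf_den /= in h; lia.
by have [|kn] := ltnP m (cf_den b k); [exact: IH|exists k; rewrite kn].
Qed.

(** Each step of the recursion has determinant -1. The ring is arbitrary because [int] serves for
    the lattice basis and [R] for the values at convergents. *)
Lemma continuants_det (T : comNzRingType) b n :
  let p := continuants b (1, 0) n in let q := continuants b (0, 1) n in
  q.2%:R * p.1%:R - q.1%:R * p.2%:R = (-1) ^+ n :> T.
Proof.
elim: n => [|n]; rewrite /=; first by ring.
set p := continuants b (1, 0) n; set q := continuants b (0, 1) n => IH.
by rewrite exprS -IH; ring.
Qed.

(* The remainder [q_n alpha - p_n]. *)
Definition cf_rem b n : R := (cf_den b n)%:R * cf b - (cf_num b n)%:R.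

Lemma cf_remS b n : cf_rem b n.+1 = - cf (tail_from b n.+1) * cf_rem b n.
Proof.
rewrite /cf_rem /cf_den /cf_num.
(* The induction runs over pairs of consecutive continuants so that it can start at [k = 0], where
   the previous denominator is 0. *)
suff H k : let p := continuants b (1, 0) k in let q := continuants b (0, 1) k in
    q.2%:R * cf b - p.2%:R = - cf (tail_from b k) * (q.1%:R * cf b - p.1%:R) :> R.
  exact: (H n.+1).
elim: k => [|k] /=; first by rewrite (_ : tail_from b 0 = b)//=; ring.
set p := continuants b (1, 0) k; set q := continuants b (0, 1) k.
rewrite (cf_tail b k) /cf_step; have := @cf_bounds R (tail_from b k.+1).
move: (cf (tail_from b k.+1)) => y hy; have hd := @digit_bounds R (b k).
have z : 3 + (b k)%:R + y != 0 by apply/eqP; lra.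
move=> IH.
have IH' : q.1%:R * cf b - p.1%:R = - (3 + (b k)%:R + y) * (q.2%:R * cf b - p.2%:R) :> R.
  by rewrite IH; field.
transitivity ((3 + (b k)%:R) * (q.2%:R * cf b - p.2%:R) + (q.1%:R * cf b - p.1%:R) : R).
  by ring.
by rewrite IH'; ring.
Qed.


Lemma cf_back_den b n : cf_back b n = (continuants b (0, 1) n).1%:R / (cf_den b n)%:R.
Proof.
elim: n => [|n IH]; first by rewrite mul0r.
have := cf_den_ge b n; rewrite /cf_den => -[q0 _].
rewrite [LHS]/= IH /cf_den /=; move: (continuants b (0, 1) n) q0 => q q0.
rewrite /cf_step; have hd := @digit_bounds R (b n).
have q1 : 0 < q.2%:R :> R by rewrite ltr0n.
have q2 : 0 <= q.1%:R :> R by rewrite ler0n.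
field.
by apply/andP; split; apply/eqP; nra.
Qed.

(* The value [m ^ 2 (k / m - cf b)] at the [n]-th convergent [k / m]. *)
Definition cf_val b n : R := (-1) ^+ n.+1 * cf_pair (cf (tail_from b n)) (cf_back b n).

(** With y the tail from [n], alpha = (p_n + y p_(n-1)) / (q_n + y q_(n-1)), and the determinant
    turns - q_n (q_n alpha - p_n) into (-1)^(n+1) y q_n / (q_n + y q_(n-1)). *)
Lemma cf_val_rem b n : cf_val b n = - (cf_den b n)%:R * cf_rem b n.
Proof.
have q0 : 0 < (cf_den b n)%:R :> R by rewrite ltr0n; case: (cf_den_ge b n).
rewrite /cf_val /cf_pair cf_back_den.
have H : cf_rem b n = - cf (tail_from b n) *
    ((continuants b (0, 1) n).1%:R * cf b - (continuants b (1, 0) n).1%:R).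
  case: n {q0} => [|n]; last exact: cf_remS.
  by rewrite /cf_rem /cf_den /cf_num /= (_ : tail_from b 0 = b)//; ring.
have := continuants_det R b n; rewrite exprS; rewrite /= => <-.
move: H q0; rewrite /cf_rem /cf_den /cf_num.
move: (continuants b (0, 1) n) (continuants b (1, 0) n) => q p.
have := @cf_bounds R (tail_from b n); move: (cf (tail_from b n)) (cf b) => y x hy H q0.
have q2 : 0 <= q.1%:R :> R by rewrite ler0n.
apply: (@mulIf _ (q.2%:R + q.1%:R * y)); first by apply/eqP; nra.
transitivity (- y * q.2%:R * (q.2%:R * p.1%:R - q.1%:R * p.2%:R) : R).
  by field; apply/andP; split; apply/eqP; nra.
have -> : p.2%:R = q.2%:R * x + y * (q.1%:R * x - p.1%:R) :> R.
  by move/eqP: H; rewrite subr_eq => /eqP ->; ring.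
by ring.
Qed.

Lemma cf_ge b : 1 / 5 <= cf b :> R.
Proof.
rewrite cfE /cf_step; have := @cf_bounds R (fun n => b n.+1).
have := @digit_bounds R (b 0%N).
by move: (cf _) => y hd hy; rewrite -[leRHS]div1r ler_pdivlMr; lra.
Qed.

(** The lower bound excludes proper multiples of a convergent: they multiply the value by at least
    4, and 4 / 8 is already 1/2. *)
Lemma cf_val_norm b n : 1 / 8 <= `|cf_val b n| <= 1 / 3.
Proof.
rewrite /cf_val normrMsign /cf_pair.
have := cf_back_bounds b n; have := cf_ge (tail_from b n); have := @cf_bounds R (tail_from b n).
move: (cf _) (cf_back _ _) => y r hy hy' hr.
have h : 0 <= r * y <= 1 / 9 by nra.
rewrite ger0_norm; last by apply: divr_ge0; lra.
by rewrite ler_pdivlMr ?ler_pdivrMr; lra.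
Qed.


(* [(Q, P)], [(Q1, P1)] is a basis of the lattice of pairs [(m, k)]. *)
Lemma legendre_lattice (x y : R) (k e : int) (m P Q P1 Q1 : nat) :
  e ^+ 2 = 1 -> Q1%:Z * P%:Z - Q%:Z * P1%:Z = e ->
  (0 < Q)%N -> (Q <= m)%N -> (m < Q1)%N -> 0 < y ->
  Q1%:R * x - P1%:R = - y * (Q%:R * x - P%:R) ->
  1 / 8 <= `|Q%:R * (Q%:R * x - P%:R)| ->
  `|m%:R * (k%:~R - m%:R * x)| < 1 / 2 ->
  m%:R * (k%:~R - m%:R * x) = - (Q%:R * (Q%:R * x - P%:R)).
Proof.
move=> ee det Q0 Qm mQ1 y0 rem Q8 small.
(* Cramer's rule for the coordinates of [(m, k)] in the basis; the determinant [e] is its own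
   inverse. *)
pose u := e * (k * Q1%:Z - m%:Z * P1%:Z); pose v := e * (m%:Z * P%:Z - k * Q%:Z).
have Hm : m%:Z = u * Q%:Z + v * Q1%:Z.
  transitivity (m%:Z * (e * (Q1%:Z * P%:Z - Q%:Z * P1%:Z))); last by rewrite /u /v; ring.
  by rewrite det -expr2 ee mulr1.
have Hk : k = u * P%:Z + v * P1%:Z.
  transitivity (k * (e * (Q1%:Z * P%:Z - Q%:Z * P1%:Z))); last by rewrite /u /v; ring.
  by rewrite det -expr2 ee mulr1.
have Hv : v = e * (m%:Z * P%:Z - k * Q%:Z) by [].
clearbody u v.
have RHm : m%:R = u%:~R * Q%:R + v%:~R * Q1%:R :> R.
  by have := congr1 (fun z : int => z%:~R : R) Hm; rewrite rmorphD !rmorphM.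
have RHk : k%:~R = u%:~R * P%:R + v%:~R * P1%:R :> R.
  by have := congr1 (fun z : int => z%:~R : R) Hk; rewrite rmorphD !rmorphM.
have RHv : v%:~R = e%:~R * (m%:R * P%:R - k%:~R * Q%:R) :> R.
  by have := congr1 (fun z : int => z%:~R : R) Hv; rewrite rmorphM rmorphB !rmorphM.
set t := Q%:R * x - P%:R in rem Q8 *.
have HE : m%:R * x - k%:~R = t * (u%:~R - v%:~R * y).
  rewrite RHm RHk.
  transitivity (u%:~R * t + v%:~R * (Q1%:R * x - P1%:R)); first by rewrite /t; ring.
  by rewrite rem; ring.
(* If [v] is nonzero, [0 < m < Q1] forces [u] to be nonzero of the opposite sign, so [u] and
   [- v * y] add up without cancellation. *)
have u1 : 1 <= `|u%:~R - v%:~R * y|.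
  have [v0|[v1|v1]] : v = 0 \/ 1 <= v \/ v <= -1 by lia.
  - by rewrite v0 mul0r subr0 -intr_norm (ler_int R 1); nia.
  - have : u <= -1 by nia.
    move: v1; rewrite -(ler_int R 1 v) -(ler_int R u (-1)) => v1 u1.
    rewrite ltr0_norm; nra.
  - have : 1 <= u by nia.
    move: v1; rewrite -(ler_int R v (-1)) -(ler_int R 1 u) => v1 u1.
    rewrite gtr0_norm; nra.
have E0 : 0 <= `|m%:R * x - k%:~R| by [].
have m1 : 1 <= m%:R :> R by rewrite ler1n; lia.
have sm : m%:R * `|m%:R * x - k%:~R| < 1 / 2.
  by move: small; rewrite normrM distrC ger0_norm.
have tE : `|t| <= `|m%:R * x - k%:~R| by rewrite HE normrM ler_peMr.
(* Up to sign, [v] is [Q * (m * x - k) - m * t]; both products are below 1/2 in modulus, so the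
   integer [v] vanishes. *)
have v0 : v = 0.
  have : `|v%:~R| < 1 :> R.
    have -> : v%:~R = e%:~R * (Q%:R * (m%:R * x - k%:~R) - m%:R * t) :> R.
      by rewrite RHv /t; ring.
    have e1 : `|e%:~R| = 1 :> R.
      by apply/eqP; rewrite -(@eqrXn2 _ 2)// expr1n -normrX -rmorphXn ee normr1.
    rewrite normrM e1 mul1r; apply: le_lt_trans (ler_normB _ _) _.
    rewrite !normrM !normr_nat.
    have : Q%:R <= m%:R :> R by rewrite ler_nat.
    move=> /(ler_wpM2r E0) h1.
    have := ler_wpM2l (ler0n R m) tE.
    by lra.
  by rewrite -intr_norm (ltr_int R _ 1); lia.
move: HE RHm; rewrite v0 !mul0r subr0 addr0 => HE RHm.
have val : m%:R * (k%:~R - m%:R * x) = - (u%:~R ^+ 2 * (Q%:R * t)).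
  by rewrite -(opprB (m%:R * x)) HE RHm; ring.
(* Now [(m, k)] is [u] times [(Q, P)], and the bound 1/8 gives [u ^ 2 < 4]. *)
rewrite val; suff -> : u%:~R ^+ 2 = 1 :> R by rewrite mul1r.
move: small; rewrite val normrN normrM => small.
have u4 : `|u%:~R ^+ 2| < 4 :> R by nra.
rewrite v0 mul0r addr0 in Hm.
have u1' : 1 <= u by nia.
have [u2|u2] := leP 2 u; last by rewrite (_ : u = 1) ?expr1n//; lia.
move: u2 u4; rewrite -(ler_int R 2 u) ger0_norm ?sqr_ge0// => u2.
by rewrite ltNge; case/negP; rewrite expr2; nra.
Qed.

Lemma legendre_pos b (k : int) (m : nat) : (0 < m)%N ->
  `|m%:R * (k%:~R - m%:R * cf b) : R| < 1 / 2 ->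
  exists n, m%:R * (k%:~R - m%:R * cf b) = cf_val b n.
Proof.
move=> m0 hk; have [n /andP[Qm mQ]] := cf_den_bracket b _ m0.
exists n; rewrite cf_val_rem mulNr.
have [Q0 _] := cf_den_ge b n.
have det := continuants_det int b n.+1.
have ee : ((-1) ^+ n.+1 : int) ^+ 2 = 1.
  by rewrite -exprM mulnC exprM sqrrN !expr1n.
apply: (legendre_lattice _ _ _ _ _ _ _ _ _ ee _ Q0 Qm mQ (cf_gt0 _) (cf_remS b n)) => //.
  by move: det; rewrite /= !natz.
by rewrite -normrN -mulNr -cf_val_rem; case/andP: (cf_val_norm b n).
Qed.

End convergents.

(** * From convergents to finite covers of the spectrum *)

Section spectrum.
Context {R : realType}.
Implicit Types (u v x y z : R) (a b c : nat -> bool).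

Lemma approx_value_of_cf_val b n : approx_values (cf b : R) (cf_val b n).
Proof.
have [Q0 _] := cf_den_ge b n.
have q0 : (cf_den b n)%:R != 0 :> R by rewrite pnatr_eq0; lia.
exists (cf_num b n)%:Z, (cf_den b n)%:Z; split; first by lia.
by rewrite cf_val_rem /cf_rem -!pmulrn; field.
Qed.

Lemma legendre b x : approx_values (cf b : R) x -> `|x| < 1 / 2 ->
  exists n, x = cf_val b n.
Proof.
move=> [k [m [m0 ->]]].
have mR : m%:~R != 0 :> R by rewrite intr_eq0.
have -> : m%:~R ^+ 2 * (k%:~R / m%:~R - cf b) = m%:~R * (k%:~R - m%:~R * cf b) :> R.
  by field.
(* The pairs (k, m) and (-k, -m) give the same value, so a positive denominator suffices. *)
have [n [mE|mE]] : exists n : nat, m = n \/ m = - n%:Z by exists `|m|%N; lia.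
  by rewrite mE => /legendre_pos; apply; lia.
rewrite mE mulrNz -pmulrn => h.
have e : - n%:R * (k%:~R - - n%:R * cf b) = n%:R * ((- k)%:~R - n%:R * cf b) :> R.
  by rewrite mulrNz; ring.
by move: h; rewrite e => /legendre_pos; apply; lia.
Qed.

(* The remainders [q_n alpha - p_n] are nonzero and tend to 0. *)
Lemma cf_irrational b : irrational (cf b : R).
Proof.
move=> /rationalP[A [B E]].
have B0 : B != 0%N.
  by apply/negP => /eqP B0; move: (cf_gt0 b : 0 < (_ : R)); rewrite E B0 invr0 mulr0 ltxx.
have BR : B%:R != 0 :> R by rewrite pnatr_eq0.
have Qn := cf_den_gt b B; have Q0 : 0 < (cf_den b B)%:R :> R by rewrite ltr0n; lia.
have := @cf_val_norm R b B; rewrite cf_val_rem normrM normrN normr_nat => /andP[h1 h2].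
have remE : B%:R * cf_rem b B = ((cf_den b B)%:Z * A - (cf_num b B)%:Z * B%:Z)%:~R :> R.
  by rewrite intrB !intrM -!pmulrn /cf_rem E; field.
(* This is a nonzero integer, yet [B < cf_den b B] bounds its modulus by that of [cf_val b B], hence
   by 1/3. *)
have : 1 <= `|B%:R * cf_rem b B| :> R.
  rewrite remE -intr_norm (ler_int R 1) -gtz0_ge1 normr_gt0; apply/eqP => z.
  by move: remE h1; rewrite z => /eqP; rewrite mulf_eq0 (negbTE BR) => /eqP ->; rewrite normr0; lra.
rewrite normrM normr_nat => h3.
have : B%:R * `|cf_rem b B| <= (cf_den b B)%:R * `|cf_rem b B| :> R.
  by rewrite ler_wpM2r// ler_nat ltnW.
by lra.
Qed.

(* Two equal values would give a linear equation for [cf b] with integer coefficients. *)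
Lemma cf_val_inj b : injective (cf_val b : nat -> R).
Proof.
rewrite /injective => m n; rewrite !cf_val_rem.
wlog mn : m n / (m < n)%N.
  by move=> wl e; have [/wl|/wl|//] := ltngtP m n; [apply|move=> h; apply/esym/h].
move=> E; exfalso; apply: (cf_irrational b); apply/rationalP.
have Qmn := cf_den_ltn b _ _ mn.
have D : (cf_den b m ^ 2 < cf_den b n ^ 2)%N by rewrite ltn_sqr.
exists ((cf_den b n * cf_num b n)%:Z - (cf_den b m * cf_num b m)%:Z).
exists (cf_den b n ^ 2 - cf_den b m ^ 2)%N.
rewrite natrB; last exact: ltnW.
have DR : (cf_den b n ^ 2)%:R - (cf_den b m ^ 2)%:R != 0 :> R.
  by rewrite subr_eq0 eqr_nat; lia.
apply: (mulIf DR); rewrite divfK// intrB -!pmulrn !natrM.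
move/eqP: E; rewrite -subr_eq0 => /eqP E; apply: subr0_eq; rewrite -[RHS]E /cf_rem.
by ring.
Qed.

Definition window b N n : bool * N.-tuple bool * N.-tuple bool :=
  (odd n, [tuple of mkseq (fun i => b (n + i)%N) N],
   [tuple of mkseq (fun i => b (n - i.+1)%N) N]).

(** Parity fixes the sign. The forward parts differ by at most 9^-N / 3; the backward parts are each
    that close to one common infinite expansion, which costs twice as much. *)
Lemma cf_val_window b N n m : (N <= n)%N -> (N <= m)%N ->
  window b N n = window b N m -> `|cf_val b n - cf_val b m : R| <= 9^-1 ^+ N.
Proof.
move=> Nn Nm [oe f1 f2].
have g1 i : (i < N)%N -> tail_from b n i = tail_from b m i.
  by move=> iN; have := congr1 (fun s => nth false s i) f1; rewrite !nth_mkseq.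
have g2 i : (i < N)%N -> b (m - i.+1)%N = b (n - i.+1)%N.
  by move=> iN; have := congr1 (fun s => nth false s i) f2; rewrite !nth_mkseq.
rewrite /cf_val -(signr_odd _ n.+1) -(signr_odd _ m.+1) /= oe -mulrBr normrMsign.
apply: le_trans (cf_pair_dist _ _ _ _ (cf_bounds _) (cf_back_bounds _ _)
  (cf_bounds _) (cf_back_bounds _ _)) _.
have h1 : `|cf (tail_from b n) - cf (tail_from b m)| <= 9^-1 ^+ N / 3 :> R by exact: cf_agree.
have h2 := cf_back_agree b N (fun i => b (n - i.+1)%N) n Nn (fun _ _ => erefl) :
  `|_ - _ : R| <= _.
have h3 := cf_back_agree b N (fun i => b (n - i.+1)%N) m Nm g2 :
  `|_ - _ : R| <= _.
have h4 := ler_distD (cf (fun i => b (n - i.+1)%N)) (cf_back b n) (cf_back b m) :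
  _ <= _ + _ :> R.
by move: h3 h4; rewrite (distrC (cf_back b m)); lra.
Qed.

Lemma spectrum_cover b N : exists2 s : seq R, (size s <= 2 * 4 ^ N + N)%N &
  forall z, approx_spectrum (cf b) z -> - (1 / 2) < z < 1 / 2 ->
  exists2 c, c \in s & `|z - c| <= 2 * 9^-1 ^+ N.
Proof.
pose rep t : R := xget 0
  [set x | exists n, [/\ (N <= n)%N, window b N n = t & x = cf_val b n]].
exists (codom rep ++
        [seq cf_val b i | i <- iota 0 N]).
  rewrite size_cat size_codom size_map size_iota !card_prod card_tuple card_bool.
  by rewrite -mulnA -expnMn.
(* This radius keeps the approximating value inside (-1/2, 1/2), where [legendre] applies. *)
move=> z zS z2; pose e : R := Num.min (9^-1 ^+ N) (Num.min (1 / 2 - z) (z + 1 / 2)).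
have e0 : 0 < e by rewrite !lt_min exprn_gt0//; lra.
have [y [_ yV]] := zS _ (nbhsx_ballx z e e0).
rewrite /ball /= !lt_min !ltr_norml => /and3P[/andP[zy1 zy2] /andP[zy3 zy4] /andP[zy5 zy6]].
have [n yn] : exists n, y = cf_val b n.
  by apply: legendre => //; rewrite ltr_norml; lra.
have [nN|Nn] := ltnP n N.
  exists y; last by rewrite ler_norml; lra.
  rewrite mem_cat yn; apply/orP; right; apply/mapP; exists n => //.
  by rewrite mem_iota.
exists (rep (window b N n)).
  by rewrite mem_cat; apply/orP; left; exact: codom_f.
have [|m [Nm wm E]] := @xgetPex _ 0 [set x : R |
  exists m, [/\ (N <= m)%N, window b N m = window b N n & x = cf_val b m]].
  by exists y; exists n.
rewrite /rep E; have := cf_val_window b N n m Nn Nm (esym wm) : `|_ - _ : R| <= _.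
by rewrite -yn !ler_norml; lra.
Qed.

End spectrum.

(** * A binary sequence containing every word after long runs of zeros *)

(* After position [2 ^ j] come the binary digits of [j], lowest first, and then zeros up to
   position [2 ^ j.+1]. *)
Definition universal (i : nat) : bool :=
  let j := trunc_log 2 i in odd (j %/ 2 ^ (i - 2 ^ j)).

(* The additional leading bit 1 makes the code large, hence preceded by a long run of zeros
   in [universal]. *)
Fixpoint bits_code (b : nat -> bool) N : nat :=
  if N is M.+1 then (b 0 + 2 * bits_code (fun i => b i.+1) M)%N else 1%N.

Lemma bits_code_bounds b N : (2 ^ N <= bits_code b N < 2 ^ N.+1)%N.
Proof.
elim: N b => [//|N IH] b; have /= := IH (fun i => b i.+1).
by rewrite !(expnS 2); case: (b 0%N) => /=; lia.
Qed.

Lemma bits_codeK b N i : (i < N)%N -> odd (bits_code b N %/ 2 ^ i) = b i.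
Proof.
elim: N b i => [//|N IH] b [_|i] /=.
  by rewrite expn0 divn1 oddD oddM addbF oddb.
rewrite ltnS => iN; rewrite expnS divnMA divnDr ?dvdn_mulr// mulKn//.
by rewrite (_ : (b 0 %/ 2 = 0)%N) ?add0n ?IH//; case: (b 0%N).
Qed.

(** The position is [2 ^ j] with [j = bits_code b N], which is even because [j > N]; evenness will
    fix the sign of the value there. *)
Lemma universal_window b N : exists n, [/\ ~~ odd n, (N < n)%N,
  forall i, (i < N)%N -> universal (n + i) = b i &
  forall i, (i < N)%N -> universal (n - i.+1) = false].
Proof.
have := bits_codeK b N; have := bits_code_bounds b N.
move: (bits_code b N) => j /andP[jN _] bj.
have Nj : (N < j)%N := leq_trans (ltn_expl N (ltnSn 1)) jN.
have j2 : (j < 2 ^ j)%N by exact: ltn_expl.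
exists (2 ^ j)%N; split.
- by rewrite oddX negb_or; lia.
- by lia.
- move=> i iN; rewrite /universal.
  have -> : trunc_log 2 (2 ^ j + i) = j.
    by apply: trunc_log_eq => //; rewrite expnS; lia.
  by rewrite addKn bj.
- move=> i iN; rewrite /universal; case: j j2 Nj {jN bj} => [//|k] _ Nk.
  have k2 : (k < 2 ^ k)%N by exact: ltn_expl.
  (* The last [k] places of block [k] have offset at least [2 ^ k - k >= k], beyond all binary
     digits of [k]. *)
  have kk : (k <= 2 ^ k - k)%N.
    have : (0 < k)%N by lia.
    case: (k) => // k' _; have := ltn_expl k' (ltnSn 1); rewrite expnS; lia.
  have -> : trunc_log 2 (2 ^ k.+1 - i.+1) = k.
    by apply: trunc_log_eq => //; rewrite expnS; lia.
  rewrite divn_small//; apply: leq_trans k2 _.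
  by rewrite leq_exp2l// expnS; lia.
Qed.

(** * Points of the spectrum parametrised by binary expansions *)

Section binary.
Context {R : realType}.
Implicit Types (t x : R).

Definition doubling t : R := if t < 1 / 2 then 2 * t else 2 * t - 1.

(** Here [true] stands for the usual binary digit 0; only agreement of digits matters. *)
Definition binary_digit t n : bool := iter n doubling t < 1 / 2.

Lemma doubling_bounds t : 0 <= t < 1 -> 0 <= doubling t < 1.
Proof. by rewrite /doubling => ht; case: ltP => h; lra. Qed.

Lemma binary_digit_dist n t x : 0 <= t < 1 -> 0 <= x < 1 ->
  (forall i, (i < n)%N -> binary_digit t i = binary_digit x i) ->
  `|t - x| <= 2^-1 ^+ n.
Proof.
elim: n t x => [|n IH] t x ht hx h; first by rewrite expr0 ler_norml; lra.
have := IH _ _ (doubling_bounds _ ht) (doubling_bounds _ hx).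
have h' i : (i < n)%N -> binary_digit (doubling t) i = binary_digit (doubling x) i.
  by move=> iN; have := h i.+1 iN; rewrite /binary_digit !iterSr.
move=> /(_ h'); have := h 0%N isT; rewrite /binary_digit /= /doubling => ->.
by case: ifP => _; rewrite exprS !ler_norml; lra.
Qed.

Definition spectrum_point t : R := - cf_pair (cf (binary_digit t)) (cf (fun=> false)).

(** If digit [n] is the first to differ, the left side is at most 32^-n, and 32^-n = 4^5 * 32^-(n+2)
    matches the separation bound. *)
Lemma spectrum_point_expand t x : 0 <= t < 1 -> 0 <= x < 1 ->
  `|t - x| ^+ 5 <= 4 ^+ 5 * `|spectrum_point t - spectrum_point x|.
Proof.
move=> ht hx; have [->|tx] := eqVneq t x; first by rewrite !subrr !normr0 mulr0 expr0n.
have : exists n, binary_digit t n != binary_digit x n.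
  apply: contrapT => /forallNP h; case/eqP: tx; apply/eqP; rewrite -subr_eq0 -normr_eq0.
  apply/eqP/le_anti; rewrite normr_ge0 andbT; apply/ler_addgt0Pr => e e0.
  rewrite add0r; have : (2^-1 ^+ n : R) @[n --> \oo] --> 0.
    by apply: cvg_expr; rewrite ger0_norm; lra.
  move=> /cvgr0Pnorm_lt /(_ _ e0) [N _ /(_ N (leqnn N))] /=.
  rewrite ger0_norm ?exprn_ge0// => /ltW; apply: le_trans.
  by apply: binary_digit_dist => // i _; apply/eqP; rewrite -[_ == _]negbK; apply/negP.
move=> /ex_minnP[n dn nmin].
have agree i : (i < n)%N -> binary_digit t i = binary_digit x i.
  by move=> iN; apply/eqP; apply: contraTT iN => /nmin; rewrite -leqNgt.
have h1 := binary_digit_dist _ _ _ ht hx agree.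
have h2 := cf_pair_separate _ _ _ _ (@cf_bounds R (fun=> false)) agree dn.
rewrite /spectrum_point -opprD normrN; apply: le_trans (_ : (2^-1 ^+ n) ^+ 5 <= _).
  by rewrite lerXn2r// nnegrE exprn_ge0.
apply: le_trans (ler_wpM2l _ h2); last by rewrite exprn_ge0.
rewrite -exprM mulnC exprM !exprS (_ : 2^-1 * _ = 32^-1 :> R); last by field.
have : 0 <= (32^-1 : R) ^+ n by exact: exprn_ge0.
by rewrite expr0; lra.
Qed.

Lemma spectrum_point_approx t N : exists2 n, (N < n)%N &
  `|cf_val universal n - spectrum_point t| <= 9^-1 ^+ N.
Proof.
have [n [on Nn fwd bwd]] := universal_window (binary_digit t) N.
exists n => //; rewrite /cf_val /spectrum_point -signr_odd /= on mulN1r -opprD normrN.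
apply: le_trans (cf_pair_dist _ _ _ _ (cf_bounds _) (cf_back_bounds _ _)
  (cf_bounds _) (cf_bounds _)) _.
have h1 : `|cf (tail_from universal n) - cf (binary_digit t)| <= 9^-1 ^+ N / 3 :> R.
  exact: cf_agree.
have h2 := cf_back_agree universal N (fun=> false) n (ltnW Nn) bwd : `|_ - _ : R| <= _.
have : 0 <= (9^-1 : R) ^+ N by exact: exprn_ge0.
by move: h1 h2; lra.
Qed.

Lemma spectrum_point_in t :
  (approx_spectrum (cf universal) `&` [set x : R | - (1 / 2) < x < 1 / 2])
    (spectrum_point t).
Proof.
split=> [U|/=]; last first.
  rewrite /spectrum_point /cf_pair.
  have := @cf_bounds R (binary_digit t); have := @cf_bounds R (fun=> false).
  move: (cf (binary_digit t)) (cf (fun=> false)) => u v hv hu.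
  have vu : 0 <= v * u by nra.
  have : 0 <= u / (1 + v * u) <= 1 / 3.
    by rewrite divr_ge0 ?ler_pdivrMr /=; nra.
  by move: (u / _) => p hp; lra.
move=> /nbhs_ballP[e /= e0 eU].
have [N0 hN0] := ninth_pow_small _ e0.
(* A limit point needs values different from itself; by injectivity at most one index hits it. *)
have [M hM] : exists M, forall n, (M < n)%N -> cf_val universal n != spectrum_point t.
  have [[M hM]|h] := pselect (exists n, cf_val universal n = spectrum_point t).
    exists M => n Mn; apply/eqP; rewrite -hM => /cf_val_inj nM.
    by rewrite nM ltnn in Mn.
  by exists 0%N => n _; apply/eqP => hn; apply: h; exists n.
have [n nN hn] := spectrum_point_approx t (maxn M N0).
exists (cf_val universal n); split.
- by apply: hM; rewrite (leq_ltn_trans _ nN)// leq_maxl.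
- exact: approx_value_of_cf_val.
- apply: eU; rewrite /ball /= distrC; apply: le_lt_trans hn _.
  apply: le_lt_trans hN0; apply: ler_wiXn2l; rewrite ?leq_maxr//; lra.
Qed.

End binary.

(** * Coverings and Hausdorff measure *)

Section coverings.
Context {R : realType}.
Implicit Types (A T U : set R) (s : R).

Lemma nneseries_le_finite (f : nat -> \bar R) K (w : R) :
  (forall i, (0 <= f i)%E) -> (forall i, (i < K)%N -> (f i <= w%:E)%E) ->
  (forall i, (K <= i)%N -> f i = 0%E) ->
  (\sum_(i <oo) f i <= (K%:R * w)%:E)%E.
Proof.
move=> f0 fw fK; rewrite (nneseries_split 0 K)//= add0n.
rewrite eseries0 ?adde0; last by move=> i Ki _; exact: fK.
rewrite big_mkord; apply: (@le_trans _ _ (\sum_(i < K) w%:E)%E).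
  by apply: lee_sum => i _; exact: fw.
by rewrite sumEFin sumr_const card_ord mulr_natl.
Qed.

Lemma lebesgue_measure_le_cover A (c r : nat -> R) : (forall i, 0 <= r i) ->
  (forall x, A x -> exists i, `|x - c i| <= r i) ->
  (lebesgue_measure A <= \sum_(i <oo) (2 * r i)%:E)%E.
Proof.
move=> r0 Ac; pose F i := [set` `[c i - r i, c i + r i]].
have AF : A `<=` \bigcup_i F i.
  move=> x /Ac[i xi]; exists i => //=; rewrite /F /= in_itv /=.
  by move: xi; rewrite ler_norml; lra.
(* [lebesgue_measure] unfolds to the outer measure extending interval length, which is monotone and
   subadditive on all sets. *)
apply: le_trans (le_outer_measure (wlength idfun)^*%mu _ _ AF) _.
apply: le_trans (outer_measure_sigma_subadditive (wlength idfun)^*%mu F) _.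
apply: lee_nneseries => // i _.
rewrite [leLHS](_ : _ = lebesgue_measure (F i))// lebesgue_measure_itv /= lte_fin.
by case: ifP => _; rewrite -?EFinB lee_fin; have := r0 i; lra.
Qed.

Lemma diam_ge U x y : U x -> U y -> (`|x - y|%:E <= diam U)%E.
Proof. by move=> Ux Uy; apply: ereal_sup_ubound; exists x => //; exists y. Qed.

Lemma diam_pow_ge0 s U : (0 <= diam_pow s U)%E.
Proof. by rewrite /diam_pow; case: ifP => // _; exact: poweR_ge0. Qed.

Lemma diam_pow_le s U (d : R) : 0 <= s -> 0 <= d ->
  (diam U <= d%:E)%E -> (diam_pow s U <= (d `^ s)%:E)%E.
Proof.
move=> s0 d0 Ud; rewrite /diam_pow; case: ifPn => [_|/set0P[x Ux]].
  by rewrite lee_fin powR_ge0.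
have := diam_ge _ _ _ Ux Ux; rewrite subrr normr0 => U0.
by rewrite -poweR_EFin gt0_ler_poweR// in_itv /= ?leey ?andbT// lee_fin.
Qed.

(** Finite covers by intervals of a common length [d]; one [e] bounds both the mesh and the
    [s]-sum. *)
Definition small_covers s A := forall e : R, 0 < e -> exists (c : seq R) (d : R),
  [/\ 0 <= d <= e, (size c)%:R * d `^ s <= e &
      forall z, A z -> exists2 x, x \in c & `|z - x| <= d / 2].

Lemma hausdorff_measure0 s A : 0 <= s -> small_covers s A -> hausdorff_measure s A = 0%E.
Proof.
move=> s0 cov.
have pre0 (U : nat -> set R) : (0 <= \sum_(i <oo) diam_pow s (U i))%E.
  by apply: nneseries_ge0 => i _ _; exact: diam_pow_ge0.
apply/le_anti/andP; split; last first.
  apply: le_ereal_sup_tmp; exists (hausdorff_premeasure s 1 A); first by exists 1 => /=.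
  by apply: le_ereal_inf_tmp => _ [U _ <-]; exact: pre0.
apply: ge_ereal_sup => _ [delta /= delta0 <-].
apply/lee_addgt0Pr => e e0; rewrite add0e.
have [|c [d [d1 d2 Ac]]] := cov (Num.min delta e); first by rewrite lt_min delta0.
rewrite !le_min in d1 d2.
(* Padding with empty sets costs nothing, even for [s = 0], by the convention in [diam_pow]. *)
pose U (i : nat) : set R := if (i < size c)%N then [set z | `|z - nth 0 c i| <= d / 2] else set0.
have Ud i : (diam (U i) <= d%:E)%E.
  apply: ge_ereal_sup => _ [x Ux [y Uy <-]].
  move: Ux Uy; rewrite /U; case: ifP => // _ /=.
  by rewrite lee_fin !ler_norml; lra.
apply: (@le_trans _ _ (\sum_(i <oo) diam_pow s (U i))%E).
  apply: ereal_inf_lbound; exists U => //; split.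
    move=> z /Ac[x xc zx]; exists (index x c) => //.
    by rewrite /U index_mem xc /= nth_index.
  by move=> i; apply: le_trans (Ud i) _; rewrite lee_fin; lra.
apply: (@le_trans _ _ ((size c)%:R * d `^ s)%:E); last by rewrite lee_fin; lra.
apply: nneseries_le_finite => [i|i _|i ci]; first exact: diam_pow_ge0.
  by apply: diam_pow_le => //; lra.
by rewrite /U ltnNge ci /= /diam_pow eqxx.
Qed.

(** Covers with [d <= 1] have [d <= d ^ s], so their total length is at most the [s]-sum. *)
Lemma lebesgue_measure0 s A : s <= 1 -> small_covers s A -> lebesgue_measure A = 0%E.
Proof.
move=> s1 cov; apply/le_anti; rewrite measure_ge0 andbT.
apply/lee_addgt0Pr => e e0; rewrite add0e.
have [|c [d [d1 d2 Ac]]] := cov (Num.min 1 e); first by rewrite lt_min ltr01.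
rewrite !le_min in d1 d2.
apply: le_trans (lebesgue_measure_le_cover _ (fun i => nth 0 c i)
  (fun i => if (i < size c)%N then d / 2 else 0) _ _) _.
- by move=> i; case: ifP => //; lra.
- by move=> x /Ac[y yc xy]; exists (index y c); rewrite index_mem yc nth_index.
apply: (@le_trans _ _ ((size c)%:R * d)%:E).
  apply: nneseries_le_finite => [i|i ic|i ic].
  - by rewrite lee_fin; case: ifP => //; lra.
  - by rewrite ic lee_fin; lra.
  - by rewrite ltnNge ic /= mulr0.
rewrite lee_fin; apply: (@le_trans _ _ ((size c)%:R * d `^ s)); last by lra.
rewrite ler_wpM2l//.
have [->|dn0] := eqVneq d 0; first by rewrite powR_ge0.
have dp : 0 < d <= 1 by rewrite lt_neqAle eq_sym dn0; lra.
by rewrite -[leLHS]powRr1 ?ger_powR//; lra.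
Qed.

(** A cover of [A] by sets of diameter d <= 1 pulls back to a cover of [T] by intervals of radius C
    d^s0 <= C d^s. If the [s]-sums could be arbitrarily small, [T] would be null. *)
Lemma hausdorff_measure_neq0 s s0 (C : R) A T (F : R -> R) :
  0 <= s <= s0 -> 0 < s0 -> 0 < C -> (0 < lebesgue_measure T)%E ->
  (forall t, T t -> A (F t)) ->
  (forall t x, T t -> T x -> `|t - x| <= C * `|F t - F x| `^ s0) ->
  hausdorff_measure s A != 0%E.
Proof.
move=> ss0 s00 C0 T0 TA hF; apply/negP => /eqP H0.
suff : (lebesgue_measure T <= 0)%E by rewrite leNgt T0.
apply/lee_addgt0Pr => e e0; rewrite add0e.
have : (hausdorff_premeasure s 1 A < (e / (2 * C))%:E)%E.
  apply: (@le_lt_trans _ _ 0%E); last by rewrite lte_fin divr_gt0// mulr_gt0.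
  by rewrite -H0; apply: ereal_sup_ubound; exists 1 => //=.
move=> /ereal_inf_lt[_ [U [AU Ud] <-]] Ue.
have /choice[p hp] : forall i, exists p : R * R, [/\ 0 <= p.2,
    forall t, T t -> U i (F t) -> `|t - p.1| <= p.2 &
    ((2 * p.2)%:E <= (2 * C)%:E * diam_pow s (U i))%E].
  (* The centre is any point of [T] sent into [U i]; if there is none, a degenerate interval
     does. *)
  move=> i; have [[t0 [Tt0 Ut0]]|none] := pselect (exists t, T t /\ U i (F t)); last first.
    exists (0, 0); split => //=; first by move=> t Tt Ut; case: none; exists t.
    by rewrite mulr0 mule_ge0 ?diam_pow_ge0// lee_fin; lra.
  have := diam_ge _ _ _ Ut0 Ut0; rewrite subrr normr0.
  have := Ud i; have dU := diam_ge (U i).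
  have Un0 : U i != set0 by apply/set0P; exists (F t0).
  rewrite /diam_pow (negbTE Un0).
  case: (diam (U i)) dU => [d| |]//= dU; rewrite !lee_fin => d1 d0.
  exists (t0, C * d `^ s0); split => /=.
  - by rewrite mulr_ge0 ?powR_ge0// ltW.
  - move=> t Tt Ut; apply: le_trans (hF _ _ Tt Tt0) _.
    rewrite ler_pM2l//; apply: ge0_ler_powR; rewrite ?nnegrE//; first exact: ltW.
    by rewrite -lee_fin; exact: dU.
  - rewrite mulrA -EFinM lee_fin ler_pM2l ?mulr_gt0//.
    have [->|dn0] := eqVneq d 0; first by rewrite powR0 ?powR_ge0 ?gt_eqF.
    by apply: ger_powR; rewrite ?lt_neqAle 1?eq_sym ?dn0; lra.
apply: le_trans (lebesgue_measure_le_cover _ (fun i => (p i).1) (fun i => (p i).2) _ _) _.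
- by move=> i; case: (hp i).
- move=> t Tt; have [i _ Ui] := AU _ (TA _ Tt); exists i.
  by case: (hp i) => _ /(_ _ Tt Ui).
apply: (@le_trans _ _ (\sum_(i <oo) ((2 * C)%:E * diam_pow s (U i)))%E).
  apply: lee_nneseries => i _; case: (hp i) => // p0 _ _.
  by rewrite lee_fin mulr_ge0.
rewrite nneseriesZl; last by move=> i _; exact: diam_pow_ge0.
have C2 : 0 < 2 * C by rewrite mulr_gt0.
rewrite muleC -lee_pdivlMr//; exact: ltW.
Qed.

End coverings.

(** * Upper and lower bounds for the dimension *)

Section dimension.
Context {R : realType}.

Lemma spectrum_small_covers b : small_covers (3 / 4)
  (approx_spectrum (cf b) `&` [set x : R | - (1 / 2) < x < 1 / 2]).
Proof.
move=> e e0; pose k : R := 9^-1 `^ (3 / 4); pose q := 4 * k.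
have k0 : 0 <= k by exact: powR_ge0.
(* Fourth powers replace the comparison 4 < 9^(3/4) by 256 < 729. *)
have k4 : k ^+ 4 = 729^-1.
  rewrite /k -powR_mulrn ?powR_ge0// -powRrM (_ : 3 / 4 * 4%:R = 3%:R); last by field.
  by rewrite powR_mulrn ?invr_ge0//; field.
have q1 : `|q| < 1.
  rewrite ger0_norm ?mulr_ge0// ltNge; apply/negP => /(exprn_ege1 4).
  by rewrite exprMn k4; lra.
have kq : 9^-1 <= q.
  have : 9^-1 `^ 1 <= k by apply: ger_powR; lra.
  by rewrite powRr1 ?invr_ge0// /q; lra.
have : (q ^+ n) @[n --> \oo] --> 0 by exact: cvg_expr.
(* At most 3 * 4^N intervals, each contributing at most 4 * k^N, sum to 12 * q^N. *)
move=> /cvgr0Pnorm_lt /(_ (e / 12)) [|N _ /(_ N (leqnn N))] /=; first by lra.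
have qN0 : 0 <= q ^+ N by rewrite exprn_ge0// mulr_ge0.
rewrite ger0_norm// => qN.
have [c cN cS] := spectrum_cover b N : exists2 c : seq R, _ & _.
exists c, (4 * 9^-1 ^+ N); split.
- have : (9^-1 : R) ^+ N <= q ^+ N by rewrite lerXn2r// nnegrE ?mulr_ge0.
  have : 0 <= (9^-1 : R) ^+ N by exact: exprn_ge0.
  lra.
- have dN : (4 * 9^-1 ^+ N) `^ (3 / 4) <= 4 * k ^+ N.
    rewrite powRM ?exprn_ge0//; apply: ler_pM; rewrite ?powR_ge0//.
      by rewrite -[leRHS]powRr1//; apply: ler_powR; lra.
    by rewrite -!powR_mulrn// powRAC.
  have cN3 : (size c)%:R <= 3 * 4 ^+ N :> R.
    rewrite -natrX -natrM ler_nat; apply: leq_trans cN _.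
    by have := ltn_expl N (isT : 1 < 4)%N; lia.
  have h : (size c)%:R * (4 * 9^-1 ^+ N) `^ (3 / 4) <= 3 * 4 ^+ N * (4 * k ^+ N).
    by apply: ler_pM => //; exact: powR_ge0.
  have qE : 3 * 4 ^+ N * (4 * k ^+ N) = 12 * q ^+ N.
    by rewrite /q exprMn; move: (4 ^+ N) (k ^+ N) => f g; ring.
  lra.
- move=> z [zS z2]; have [x xc zx] := cS z zS z2; exists x => //; lra.
Qed.

Lemma spectrum_point_holder t x : 0 <= t < 1 -> 0 <= x < 1 ->
  `|t - x| <= 4 * `|spectrum_point t - spectrum_point x : R| `^ 5^-1.
Proof.
move=> ht hx; have := spectrum_point_expand _ _ ht hx.
move: `|_ - _ : R| (normr_ge0 (t - x)) `|spectrum_point _ - _ : R|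
  (normr_ge0 (spectrum_point t - spectrum_point x)) => a a0 d d0.
have dE : (d `^ 5^-1) ^+ 5 = d.
  by rewrite -powR_mulrn ?powR_ge0// -powRrM mulVf ?powRr1.
by rewrite -{1}dE -exprMn ler_pXn2r// nnegrE// mulr_ge0 ?powR_ge0.
Qed.


End dimension.

Theorem theorem13 (R : realType) :
  exists alpha : R,
    let S := approx_spectrum alpha `&` [set x : R | - (1 / 2) < x < 1 / 2] in
    [/\ irrational alpha,
        (0 < hausdorff_dim S)%E /\ (hausdorff_dim S < 1)%E,
        ~ countable S
      & lebesgue_measure S = 0%E].
Proof.
have T1 : lebesgue_measure [set t : R | 0 <= t < 1] = 1%E.
  have -> : [set t : R | 0 <= t < 1] = [set` `[0, 1[].
    by apply/seteqP; split => t /=; rewrite in_itv.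
  by rewrite lebesgue_measure_itv /= lte_fin ltr01 oppr0 adde0.
have small := @spectrum_small_covers R universal.
exists (cf universal) => S; split.
- exact: cf_irrational.
- split.
    apply: (@lt_le_trans _ _ (5^-1)%:E); first by rewrite lte_fin invr_gt0.
    apply: le_ereal_inf_tmp => _ [s [s0 Hs] <-]; rewrite lee_fin leNgt.
    apply/negP => s5; apply/eqP: Hs.
    apply: (hausdorff_measure_neq0 _ 5^-1 4 _ [set t | 0 <= t < 1] spectrum_point) => //.
    + by rewrite s0 ltW.
    + by rewrite T1.
    + by move=> t _; exact: spectrum_point_in.
    + exact: spectrum_point_holder.
  apply: (@le_lt_trans _ _ (3 / 4)%:E); last by rewrite lte_fin; lra.
  apply: ereal_inf_lbound; exists (3 / 4) => //; split; first by lra.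
  by apply: hausdorff_measure0 small; lra.
- move=> Sc; have : lebesgue_measure [set t : R | 0 <= t < 1] = 0%E.
    apply: countable_lebesgue_measure0.
    (* The Hoelder bound makes [spectrum_point] injective on [0, 1), so a countable spectrum would
       make [0, 1) countable and null. *)
    have inj : {in [set t : R | 0 <= t < 1] &, injective (@spectrum_point R)}.
      move=> t x; rewrite !inE => ht hx E; have := spectrum_point_holder _ _ ht hx.
      by rewrite E subrr normr0 powR0// mulr0 normr_le0 subr_eq0 => /eqP.
    rewrite -(eq_countable (inj_card_eq inj)); apply: sub_countable Sc.
    by apply: subset_card_le => _ [t _ <-]; exact: spectrum_point_in.
  by rewrite T1 => /eqP; rewrite onee_eq0.
- by apply: lebesgue_measure0 small; lra.
Qed.
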